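(* Suppose we are given $k$ separate conditional encryption schemes $\Pi_1,\dots,\Pi_k$ with a common message space $\mathcal M$ for predicates $P_1,\dots,P_k$, and that each $\Pi_i$ provides $(t(\lambda),t_{\mathsf{Sim},i}(\lambda),\epsilon_i(t(\lambda),\lambda))$-conditional encryption secrecy. Then the OR-composition $\Pi_{or}$ (described in the context), for the predicate $P_{or}=\bigvee_{i=1}^kP_i$, provides $(t'(\lambda),t'_{\mathsf{Sim}}(\lambda),\epsilon'(t'(\lambda),\lambda))$-conditional encryption secrecy with $$t'(\lambda)=O(t(\lambda)),\qquad t'_{\mathsf{Sim}}(\lambda)\approx\sum_{i=1}^kt_{\mathsf{Sim},i}(\lambda),\qquad \epsilon'(t'(\lambda),\lambda)=\sum_{i=1}^k\epsilon_i(t'(\lambda),\lambda).$$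
   Context: **Conditional encryption.** For a binary predicate $P:\mathcal M\times\mathcal M\to\{0,1\}$, a conditional encryption scheme consists of algorithms $(\mathsf{KeyGen},\mathsf{Enc},\mathsf{CondEnc},\mathsf{Dec})$: $(sk,pk)=\mathsf{KeyGen}(1^\lambda;r)$; $\mathsf{Enc}_{pk}(m_1;r)$ outputs a ciphertext with flag $0$; $\mathsf{CondEnc}_{pk}(c,m_2,m_3;r)$ takes a regular (flag $0$) ciphertext, a control message $m_2$ and a payload message $m_3$ and outputs a ciphertext with flag $1$ (and outputs $\bot$ if the input ciphertext has flag $1$); $\mathsf{Dec}_{sk}$ outputs a message in $\mathcal M$ or $\bot$. *Conditional encryption secrecy.* The scheme provides $(t,t_{\mathsf{Sim}},\epsilon)$-conditional encryption secrecy if there is a simulator $\mathsf{Sim}$ running in time at most $t_{\mathsf{Sim}}(\lambda)$ such that for all $m_1,m_2,m_3\in\mathcal M$ with $P(m_1,m_2)=0$, all $\lambda$, all coins $r,r_1$, and all distinguishers $\mathcal D$ running in time at most $t(\lambda)$, with $(sk,pk)=\mathsf{KeyGen}(1^\lambda;r)$ and $c_1=\mathsf{Enc}_{pk}(m_1;r_1)$, $$\big|\Pr[\mathcal D(sk,pk,m_1,m_2,m_3,c_1,\mathsf{Sim}(pk))=1]-\Pr[\mathcal D(sk,pk,m_1,m_2,m_3,c_1,\mathsf{CondEnc}_{pk}(c_1,m_2,m_3))=1]\big|\le\epsilon(t(\lambda),\lambda),$$ probabilities over the coins of $\mathcal D$, $\mathsf{Sim}$ and $\mathsf{CondEnc}$.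 **OR-composition $\Pi_{or}$.** $P_{or}(m_1,m_2)=0$ iff $P_i(m_1,m_2)=0$ for all $i\le k$. - $\mathsf{KeyGen}(1^\lambda)$: run $(sk_i,pk_i)\leftarrow\Pi_i.\mathsf{KeyGen}(1^\lambda)$ for each $i$; $sk=(sk_1,\dots,sk_k)$, $pk=(pk_1,\dots,pk_k)$. - $\mathsf{Enc}_{pk}(m)=(0,c_1,\dots,c_k)$ with $c_i=\Pi_i.\mathsf{Enc}_{pk_i}(m)$. - $\mathsf{CondEnc}_{pk}((0,c_1,\dots,c_k),m',m'')=(1,\tilde c_1,\dots,\tilde c_k)$ with $\tilde c_i=\Pi_i.\mathsf{CondEnc}_{pk_i}(c_i,m',m'')$; output $\bot$ if some $\tilde c_i=\bot$. - $\mathsf{Dec}_{sk}$: decrypt each component with $\Pi_i.\mathsf{Dec}_{sk_i}$ to obtain $m_i\in\mathcal M\cup\{\bot\}$; output $\bot$ if all $m_i=\bot$, otherwise output $m_j$ for the largest $j$ with $m_j\ne\bot$. The symbol $\approx$ means equality up to the (lower-order) cost of concatenating the outputs. *)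

(* Defs.v *)
From HB Require Import structures.
From mathcomp Require Import all_boot all_order all_algebra.
From mathcomp Require Import all_reals.

Set Implicit Arguments.
Unset Strict Implicit.
Unset Printing Implicit Defensive.

Import Order.TTheory GRing.Theory Num.Theory.
Local Open Scope ring_scope.

(* A bit string whose positions are named by [W].  A tuple of strings is a
   string over a sum of position types.  [W] may be infinite: a string of
   variable length is, for instance, a string over [nat * bool], with one
   presence bit and one value bit for each position. *)
Definition bits (W : Type) : Type := W -> bool.

Definition coins (W : finType) : Type := {ffun W -> bool}.

Definition prob (R : realType) (T : finType) (E : pred T) : R :=
  #|[pred x | E x]|%:R / #|T|%:R.

(* The source of a bit in a circuit with input positions [I] and [n] coins. *)
Inductive source (I : Type) (n : nat) : Type :=
| SConst of bool
| SInput of I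
| SCoin of 'I_n
| SGate of nat.

(* A straight-line program of NAND gates over uniform coins.  Gate number [j]
   may only use gates of smaller number; any other gate reference reads
   [false]. *)
Record circuit (I O : Type) : Type := Circuit {
  ccoins : nat;
  cgates : seq (source I ccoins * source I ccoins);
  couts : O -> source I ccoins
}.

(* Running time is non-uniform: the size of the circuit, with one unit for each
   coin toss and each gate.  Constants, reading inputs and naming outputs are
   free, so concatenating outputs costs nothing. *)
Definition ctime (I O : Type) (C : circuit I O) : nat :=
  (ccoins C + size (cgates C))%N.

Definition source_val (I : Type) (n : nat) (x : bits I) (rho : coins 'I_n)
    (gs : seq bool) (s : source I n) : bool :=
  match s with
  | SConst b => b
  | SInput i => x i
  | SCoin j => rho j
  | SGate j => nth false gs j
  end.

Definition gate_vals (I : Type) (n : nat) (x : bits I) (rho : coins 'I_n)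
    (gates : seq (source I n * source I n)) : seq bool :=
  foldl (fun gs g =>
           rcons gs (~~ (source_val x rho gs g.1 && source_val x rho gs g.2)))
        [::] gates.

Definition run (I O : Type) (C : circuit I O) (x : bits I)
    (rho : coins 'I_(ccoins C)) : bits O :=
  fun o => source_val x rho (gate_vals x rho (cgates C)) (couts C o).

Arguments run {I O} C x rho.

Record message_space : Type := MessageSpace {
  msg :> Type;
  msg_pos : Type;
  msg_bits : msg -> bits msg_pos;
  msg_bits_inj : injective msg_bits
}.

(* A ciphertext is its flag (0 is [false], 1 is [true]) and its body. *)
Definition ctxt (W : Type) : Type := (bool * bits W)%type.

(* The flag sits at position [None]. *)
Definition ctxt_bits (W : Type) (c : ctxt W) : bits (option W) :=
  fun w => if w is Some w' then c.2 w' else c.1.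

Definition bits_ctxt (W : Type) (v : bits (option W)) : ctxt W :=
  (v None, fun w => v (Some w)).

(* The output of CondEnc is a ciphertext or bottom, which is [None]; position
   [None] of its encoding tells the two apart. *)
Definition octxt_bits (W : Type) (oc : option (ctxt W)) :
    bits (option (option W)) :=
  fun w => if oc is Some c
           then (if w is Some w' then ctxt_bits c w' else true)
           else false.

(* The predicate is not part of the scheme: it is an argument of the security
   notion.  The [nat] argument is the security parameter.  The algorithms are
   functions of their coins; no bound is put on the cost of computing them.
   [cond_enc_regular] concerns honest inputs only: on a flag-0 body that was
   not produced by [enc] the output may be bottom. *)
Record scheme (M : message_space) : Type := Scheme {
  sk_pos : nat -> Type;
  pk_pos : nat -> Type;
  ct_pos : nat -> Type;
  key_coin : nat -> finType;
  enc_coin : nat -> finType;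
  cond_coin : nat -> finType;
  keygen : forall n, coins (key_coin n) -> bits (sk_pos n) * bits (pk_pos n);
  enc : forall n, bits (pk_pos n) -> M -> coins (enc_coin n) ->
    ctxt (ct_pos n);
  cond_enc : forall n, bits (pk_pos n) -> ctxt (ct_pos n) -> M -> M ->
    coins (cond_coin n) -> option (ctxt (ct_pos n));
  dec : forall n, bits (sk_pos n) -> ctxt (ct_pos n) -> option M;
  enc_flag : forall n (pk : bits (pk_pos n)) m r, (enc pk m r).1 = false;
  cond_enc_flag : forall n (pk : bits (pk_pos n)) c m2 m3 r c',
    cond_enc pk c m2 m3 r = Some c' -> c'.1 = true;
  cond_enc_bot : forall n (pk : bits (pk_pos n)) c m2 m3 r,
    c.1 = true -> cond_enc pk c m2 m3 r = None;
  cond_enc_regular : forall n (rk : coins (key_coin n)) m1 r1 m2 m3 r,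
    cond_enc (keygen rk).2 (enc (keygen rk).2 m1 r1) m2 m3 r <> None
}.

Inductive view_pos (M : message_space) (S : scheme M) (n : nat) : Type :=
| VSk of sk_pos S n
| VPk of pk_pos S n
| VM1 of msg_pos M
| VM2 of msg_pos M
| VM3 of msg_pos M
| VC1 of option (ct_pos S n)
| VC of option (option (ct_pos S n)).

Definition view (M : message_space) (S : scheme M) (n : nat)
    (sk : bits (sk_pos S n)) (pk : bits (pk_pos S n)) (m1 m2 m3 : M)
    (c1 : ctxt (ct_pos S n)) (c : option (ctxt (ct_pos S n))) :
    bits (view_pos S n) :=
  fun p => match p with
  | VSk w => sk w
  | VPk w => pk w
  | VM1 w => msg_bits m1 w
  | VM2 w => msg_bits m2 w
  | VM3 w => msg_bits m3 w
  | VC1 w => ctxt_bits c1 w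
  | VC w => octxt_bits c w
  end.

Definition simulator (M : message_space) (S : scheme M) (n : nat) : Type :=
  circuit (pk_pos S n) (option (ct_pos S n)).

Definition distinguisher (M : message_space) (S : scheme M) (n : nat) : Type :=
  circuit (view_pos S n) unit.

Definition cond_secrecy (R : realType) (M : message_space)
    (P : M -> M -> bool) (S : scheme M)
    (t tSim : nat -> nat) (eps : nat -> nat -> R) : Prop :=
  exists Sim : forall n, simulator S n,
    (forall n, (ctime (Sim n) <= tSim n)%N) /\
    forall (m1 m2 m3 : M), P m1 m2 = false ->
    forall (n : nat) (r : coins (key_coin S n)) (r1 : coins (enc_coin S n))
           (D : distinguisher S n), (ctime D <= t n)%N ->
      let sk := (keygen r).1 in
      let pk := (keygen r).2 in
      let c1 := enc pk m1 r1 in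
      `| prob R (fun w : coins 'I_(ccoins (Sim n)) * coins 'I_(ccoins D) =>
           run D (view sk pk m1 m2 m3 c1
                    (Some (bits_ctxt (run (Sim n) pk w.1)))) w.2 tt)
       - prob R (fun w : coins (cond_coin S n) * coins 'I_(ccoins D) =>
           run D (view sk pk m1 m2 m3 c1 (cond_enc pk c1 m2 m3 w.1)) w.2 tt)
       | <= eps (t n) n.

Section Or.
Variables (M : message_space) (k : nat).

Definition or_pred (P : 'I_k -> M -> M -> bool) (m1 m2 : M) : bool :=
  [exists i, P i m1 m2].

Definition join (W : 'I_k -> Type) (v : forall i, bits (W i)) :
    bits {i : 'I_k & W i} :=
  fun x => v (tag x) (tagged x).

Definition component (W : 'I_k -> Type) (i : 'I_k)
    (v : bits {i : 'I_k & W i}) : bits (W i) :=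
  fun w => v (Tagged W w).

Arguments component {W} i v.

Definition coin_component (W : 'I_k -> finType) (i : 'I_k)
    (r : coins {i : 'I_k & W i}) : coins (W i) :=
  [ffun w => r (Tagged W w)].

Arguments coin_component {W} i r.

Variable S : 'I_k -> scheme M.

(* The components of a composed ciphertext are full ciphertexts, with their
   own flags. *)
Definition or_ct_pos (n : nat) : Type := {i : 'I_k & option (ct_pos (S i) n)}.

Definition ct_component (n : nat) (i : 'I_k) (c : ctxt (or_ct_pos n)) :
    ctxt (ct_pos (S i) n) :=
  bits_ctxt (component (W := fun i => option (ct_pos (S i) n)) i c.2).

Definition or_ctxt (n : nat) (b : bool)
    (c : forall i, ctxt (ct_pos (S i) n)) : ctxt (or_ct_pos n) :=
  (b, join (fun i => ctxt_bits (c i))).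

Definition or_keygen (n : nat) (r : coins {i : 'I_k & key_coin (S i) n}) :
    bits {i : 'I_k & sk_pos (S i) n} * bits {i : 'I_k & pk_pos (S i) n} :=
  (join (fun i => (keygen (coin_component i r)).1),
   join (fun i => (keygen (coin_component i r)).2)).

Definition or_enc (n : nat) (pk : bits {i : 'I_k & pk_pos (S i) n}) (m : M)
    (r : coins {i : 'I_k & enc_coin (S i) n}) : ctxt (or_ct_pos n) :=
  or_ctxt false (fun i => enc (component i pk) m (coin_component i r)).

Definition or_cond_enc (n : nat) (pk : bits {i : 'I_k & pk_pos (S i) n})
    (c : ctxt (or_ct_pos n)) (m2 m3 : M)
    (r : coins {i : 'I_k & cond_coin (S i) n}) : option (ctxt (or_ct_pos n)) :=
  let ct i := cond_enc (component i pk) (ct_component i c) m2 m3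
                (coin_component i r) in
  if c.1 then None
  else if [forall i, isSome (ct i)]
  (* the default value is never used *)
  then Some (or_ctxt true (fun i => odflt (true, fun=> false) (ct i)))
  else None.

(* The last component that decrypts wins. *)
Definition or_dec (n : nat) (sk : bits {i : 'I_k & sk_pos (S i) n})
    (c : ctxt (or_ct_pos n)) : option M :=
  foldl (fun acc i =>
           if dec (component i sk) (ct_component i c) is Some m
           then Some m else acc)
        None (enum 'I_k).

Lemma ctxt_bitsK (W : Type) : cancel (@ctxt_bits W) (@bits_ctxt W).
Proof. by case. Qed.

Lemma or_enc_flag n pk m r : (@or_enc n pk m r).1 = false.
Proof. by []. Qed.

Lemma or_cond_enc_flag n pk c m2 m3 r c' :
  @or_cond_enc n pk c m2 m3 r = Some c' -> c'.1 = true.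
Proof. by rewrite /or_cond_enc; case: ifP => // _; case: ifP => // _ [<-]. Qed.

Lemma or_cond_enc_bot n pk c m2 m3 r :
  c.1 = true -> @or_cond_enc n pk c m2 m3 r = None.
Proof. by rewrite /or_cond_enc => ->. Qed.

Lemma ct_component_or n b (c : forall i, ctxt (ct_pos (S i) n)) i :
  ct_component i (or_ctxt b c) = c i.
Proof. exact: (ctxt_bitsK (c i)). Qed.

Lemma or_cond_enc_regular n rk m1 r1 m2 m3 r :
  @or_cond_enc n (or_keygen rk).2 (or_enc (or_keygen rk).2 m1 r1) m2 m3 r
  <> None.
Proof.
rewrite /or_cond_enc /=; case: ifP => // /negP[]; apply/forallP => i.
rewrite ct_component_or.
have := @cond_enc_regular M (S i) n (coin_component i rk) m1
  (coin_component i r1) m2 m3 (coin_component i r).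
by case: cond_enc.
Qed.

Definition or_scheme : scheme M :=
  @Scheme M (fun n => {i : 'I_k & sk_pos (S i) n})
    (fun n => {i : 'I_k & pk_pos (S i) n}) or_ct_pos
    (fun n => {i : 'I_k & key_coin (S i) n} : finType)
    (fun n => {i : 'I_k & enc_coin (S i) n} : finType)
    (fun n => {i : 'I_k & cond_coin (S i) n} : finType)
    or_keygen or_enc or_cond_enc or_dec
    or_enc_flag or_cond_enc_flag or_cond_enc_bot or_cond_enc_regular.

End Or.

(* Main.v *)
(* Hybrid argument: component by component, replace the simulated ciphertext by
   the real one.  For the step at component i, average over the coins of all
   other components; once these coins are fixed, the keys, the messages and the
   other components of the view are constants, which a distinguisher against
   scheme i may read for free.  So it has exactly the size of the given
   distinguisher, and t' = t works.  The simulator runs the given simulators in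
   parallel on disjoint blocks of coins and gates. *)
Require Import Defs.
From mathcomp Require Import all_boot all_order all_algebra.
From mathcomp Require Import all_classical all_reals all_analysis.
Import Order.TTheory GRing.Theory Num.Theory.
Local Open Scope classical_set_scope.
Local Open Scope ring_scope.

Set Implicit Arguments.
Unset Strict Implicit.
Unset Printing Implicit Defensive.

(** * Averages over finite types *)

Definition avg (R : numFieldType) (T : finType) (F : T -> R) : R :=
  (\sum_x F x) / #|T|%:R.

Lemma prob_avg (R : realType) (T : finType) (E : pred T) :
  prob R E = avg (fun x => (E x)%:R).
Proof.
rewrite /prob /avg -sum1_card natr_sum big_mkcond /=; congr (_ / _).
by apply: eq_bigr => x _; rewrite inE; case: (E x).
Qed.

Lemma avg_pair (R : numFieldType) (A B : finType) (F : A -> B -> R) :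
  avg (fun w : A * B => F w.1 w.2) = avg (fun a => avg (F a)).
Proof.
rewrite /avg -(pair_bigA _ F) /= -mulr_suml card_prod natrM invfM mulrA.
by rewrite mulrAC.
Qed.

Lemma avg_exchange (R : numFieldType) (A B : finType) (F : A -> B -> R) :
  avg (fun a => avg (F a)) = avg (fun b => avg (F^~ b)).
Proof. by rewrite /avg -!mulr_suml exchange_big mulrAC. Qed.

Lemma avg_bij (R : numFieldType) (A B : finType) (h : A -> B) (F : B -> R) :
  bijective h -> avg (fun a => F (h a)) = avg F.
Proof.
move=> hb; rewrite /avg (bij_eq_card hb) [in RHS](reindex h) //.
exact: onW_bij.
Qed.

Lemma avgB (R : numFieldType) (T : finType) (F G : T -> R) :
  avg F - avg G = avg (fun x => F x - G x).
Proof. by rewrite /avg sumrB mulrBl. Qed.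

(** [coins W] is inhabited even for empty [W], so the division is by a nonzero cardinality. This
    lets coins that a term does not read be added to an average. *)
Lemma avg_const (R : numFieldType) (W : finType) (c : R) :
  avg (fun=> c : R) (T := coins W) = c.
Proof.
have T0 : (#|{: coins W}| != 0)%N.
  by rewrite -lt0n; apply/card_gt0P; exists [ffun=> false].
by rewrite /avg sumr_const -[c *+ _]mulr_natr mulfK ?pnatr_eq0.
Qed.

Lemma ler_norm_avg (R : numFieldType) (W : finType) (F : coins W -> R) e :
  (forall x, `|F x| <= e) -> `|avg F| <= e.
Proof.
move=> Fe; rewrite -[leRHS](avg_const W) /avg normrM normfV normr_nat.
apply: ler_wpM2r; first by rewrite invr_ge0 ler0n.
exact/(le_trans (ler_norm_sum _ _ _))/ler_sum.
Qed.

(** * Resampling the coins of one component, and the hybrid sum *)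

Arguments component {k W} i v w.
Arguments coin_component {k W} i r.

Definition coin_update (k : nat) (W : 'I_k -> finType) (i : 'I_k)
    (a : coins {j : 'I_k & W j}) (u : coins (W i)) : coins {j : 'I_k & W j} :=
  [ffun w => dfwith (T := fun j => coins (W j))
               (fun j => coin_component j a) i u (tag w) (tagged w)].

Lemma coin_component_update (k : nat) (W : 'I_k -> finType) (i j : 'I_k)
    (a : coins {j : 'I_k & W j}) (u : coins (W i)) :
  coin_component j (coin_update a u) =
  dfwith (T := fun j => coins (W j)) (fun j => coin_component j a) i u j.
Proof. by apply/ffunP => w; rewrite !ffunE. Qed.

Lemma coin_updateK (k : nat) (W : 'I_k -> finType) (i : 'I_k)
    (a : coins {j : 'I_k & W j}) (u : coins (W i)) :
  coin_update (coin_update a u) (coin_component i a) = a.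
Proof.
apply/ffunP => -[j w]; rewrite ffunE /=.
case: (dfwithP (T := fun j => coins (W j))) w => [|{}j ij] w.
  by rewrite ffunE.
by rewrite coin_component_update dfwithout // ffunE.
Qed.

(* (a, u) |-> (a with u at component i, component i of a) is an involution. *)
Lemma avg_resample (R : numFieldType) (k : nat) (W : 'I_k -> finType)
    (i : 'I_k) (F : coins {j : 'I_k & W j} -> R) :
  avg F = avg (fun a => avg (fun u : coins (W i) => F (coin_update a u))).
Proof.
have -> : avg F = avg (fun a => avg (fun _ : coins (W i) => F a)).
  by congr avg; apply/funext => a; rewrite avg_const.
rewrite -avg_pair -[RHS]avg_pair.
pose h (w : coins {j : 'I_k & W j} * coins (W i)) :=
  (coin_update w.1 w.2, coin_component i w.1).
have hK : involutive h.
  case=> a u; rewrite /h /= coin_updateK coin_component_update.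
  by rewrite (dfwithin (T := fun j => coins (W j))).
exact/esym/(avg_bij (h := h) (fun w => F w.1))/inv_bij.
Qed.

(** Links the flat coins of the composed simulator with the coins tagged by component in the
    hybrids: [tagnat.rank] numbers the tagged positions bijectively. *)
Lemma avg_coin_rank (R : numFieldType) (k : nat) (p : 'I_k -> nat)
    (F : coins {i : 'I_k & 'I_(p i)} -> R) :
  avg F =
  avg (fun rho : coins 'I_(\sum_i p i) => F [ffun w => rho (tagnat.rank w)]).
Proof.
apply/esym/(avg_bij (h := fun rho : coins 'I_(\sum_i p i) =>
  [ffun w => rho (tagnat.rank w)] : coins {i : 'I_k & 'I_(p i)})).
exists (fun a : coins {i : 'I_k & 'I_(p i)} => [ffun c => a (tagnat.sig c)]);
  move=> a; apply/ffunP => c.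
  by rewrite !ffunE tagnat.sigK.
by rewrite !ffunE tagnat.rankK.
Qed.

(** The sum telescopes over hybrids [H h] whose first [h] components come from [f]. Every hybrid
    averages over both families of coins, so neighbours are compared under common [a] and [b]; the
    step bound holds for each fixed [x] and so passes through these averages. *)
Lemma hybrid_bound (R : numFieldType) (k : nat) (A B : 'I_k -> finType)
    (X : 'I_k -> Type) (f : forall i, coins (A i) -> X i)
    (g : forall i, coins (B i) -> X i) (G : (forall i, X i) -> R)
    (e : 'I_k -> R) :
  (forall (i : 'I_k) x, `|avg (fun u => G (dfwith x i (f i u)))
                 - avg (fun v => G (dfwith x i (g i v)))| <= e i) ->
  `|avg (fun a : coins {i : 'I_k & A i} =>
           G (fun i => f i (coin_component i a)))
    - avg (fun b : coins {i : 'I_k & B i} =>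
             G (fun i => g i (coin_component i b)))|
  <= \sum_i e i.
Proof.
move=> step.
pose x (h : nat) (a : coins {i : 'I_k & A i}) (b : coins {i : 'I_k & B i})
    (i : 'I_k) : X i :=
  if (i < h)%N then f i (coin_component i a) else g i (coin_component i b).
pose H h := avg (fun a => avg (fun b => G (x h a b))).
have -> : avg (fun a : coins {i : 'I_k & A i} =>
    G (fun i => f i (coin_component i a))) = H k.
  congr avg; apply/funext => a.
  rewrite -[LHS](avg_const {i : 'I_k & B i}); congr avg; apply/funext => b.
  by congr G; apply/functional_extensionality_dep => i; rewrite /x ltn_ord.
have -> : avg (fun b : coins {i : 'I_k & B i} =>
    G (fun i => g i (coin_component i b))) = H 0%N.
  by rewrite -[LHS](avg_const {i : 'I_k & A i}).
have -> : H k - H 0%N = \sum_(i < k) (H i.+1 - H i).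
  by rewrite -(big_mkord xpredT (fun i => H i.+1 - H i)) telescope_sumr.
apply: le_trans (ler_norm_sum _ _ _) (ler_sum _ _) => i _.
(* Hybrid [i.+1] reads component [i] from [a], so [a] is resampled there. At any other [j],
   [j < i.+1] and [j < i] agree, which leaves [x i a b]. *)
have -> : H i.+1 = avg (fun a => avg (fun b =>
    avg (fun u => G (dfwith (x i a b) i (f i u))))).
  rewrite /H (avg_resample i); congr avg; apply/funext => a.
  rewrite [LHS]avg_exchange; congr avg; apply/funext => b; congr avg.
  apply/funext => u; congr G; apply/functional_extensionality_dep => j.
  rewrite /x coin_component_update ltnS leq_eqVlt.
  case: dfwithP => [|{}j ij]; first by rewrite eqxx dfwithin.
  by rewrite dfwithout // val_eqE eq_sym (negPf ij).
(* Hybrid [i] reads component [i] from [b], since [i < i] fails, so [b] is resampled. Both hybrids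
   now alter the same [x i a b]. *)
have -> : H i = avg (fun a => avg (fun b =>
    avg (fun v => G (dfwith (x i a b) i (g i v))))).
  congr avg; apply/funext => a; rewrite [LHS](avg_resample i).
  congr avg; apply/funext => b; congr avg.
  apply/funext => u; congr G; apply/functional_extensionality_dep => j.
  rewrite /x coin_component_update.
  case: dfwithP => [|{}j ij]; first by rewrite ltnn dfwithin.
  by rewrite dfwithout.
rewrite avgB; apply: ler_norm_avg => a; rewrite avgB; apply: ler_norm_avg => b.
exact: step.
Qed.

(** * Renaming, hardwiring and shifting in circuits *)

Definition source_map (I J : Type) (n m : nat) (f : I -> bool + J)
    (g : 'I_n -> 'I_m) (o : nat) (s : source I n) : source J m :=
  match s with
  | SConst b => SConst _ _ b
  | SInput i => match f i with inl b => SConst _ _ b | inr j => SInput _ j end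
  | SCoin c => SCoin _ (g c)
  | SGate j => SGate _ _ (o + j)%N
  end.

Definition gates_map (I J : Type) (n m : nat) (f : I -> bool + J)
    (g : 'I_n -> 'I_m) (o : nat) (gates : seq (source I n * source I n)) :
    seq (source J m * source J m) :=
  [seq (source_map f g o p.1, source_map f g o p.2) | p <- gates].

Definition read_input (I J : Type) (f : I -> bool + J) (x : bits J) : bits I :=
  fun i => match f i with inl b => b | inr j => x j end.

Lemma source_val_map (I J : Type) (n m : nat) (f : I -> bool + J)
    (g : 'I_n -> 'I_m) (x : bits J) (rho : coins 'I_m) (pre gs : seq bool) s :
  source_val x rho (pre ++ gs) (source_map f g (size pre) s) =
  source_val (read_input f x) [ffun c => rho (g c)] gs s.
Proof.
case: s => //= [i|c|j]; first by rewrite /read_input; case: (f i).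
  by rewrite ffunE.
by rewrite nth_cat ltnNge leq_addr addKn.
Qed.

Lemma size_gate_vals (I : Type) (n : nat) (x : bits I) (rho : coins 'I_n) gates :
  size (gate_vals x rho gates) = size gates.
Proof.
elim/last_ind: gates => // gates p IH.
by rewrite /gate_vals foldl_rcons !size_rcons -/(gate_vals _ _ _) IH.
Qed.

(** A block shifted by the number of gates before it sees only its own values. A reference to a gate
    not yet computed reads [false] both before and after the shift. *)
Lemma gate_vals_cat_map (I J : Type) (n m : nat) (f : I -> bool + J)
    (g : 'I_n -> 'I_m) (x : bits J) (rho : coins 'I_m) gs0 gates :
  gate_vals x rho (gs0 ++ gates_map f g (size gs0) gates) =
  gate_vals x rho gs0
    ++ gate_vals (read_input f x) [ffun c => rho (g c)] gates.
Proof.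
elim/last_ind: gates => [|gates p IH]; first by rewrite !cats0.
rewrite /gates_map map_rcons -rcons_cat -/(gates_map f g _ gates).
rewrite /gate_vals !foldl_rcons -!/(gate_vals _ _ _) IH /= -rcons_cat.
by rewrite -(size_gate_vals x rho gs0) !source_val_map.
Qed.

(** Inputs sent to [inl] become constants, which are free, while gates and coins correspond one to
    one; hence the reduction loses no running time. *)
Definition rewire (I J O : Type) (f : I -> bool + J) (C : circuit I O) :
    circuit J O :=
  @Circuit J O (ccoins C) (gates_map f id 0 (cgates C))
    (fun o => source_map f id 0 (couts C o)).

Lemma ctime_rewire (I J O : Type) (f : I -> bool + J) (C : circuit I O) :
  ctime (rewire f C) = ctime C.
Proof. by rewrite /ctime size_map. Qed.

Lemma run_rewire (I J O : Type) (f : I -> bool + J) (C : circuit I O) x rho o :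
  run (rewire f C) x rho o = run C (read_input f x) rho o.
Proof.
have rhoE : [ffun c => rho (id c)] = rho by apply/ffunP => c; rewrite ffunE.
rewrite /run /= (gate_vals_cat_map f id x rho [::]).
by rewrite (source_val_map f id x rho [::]) rhoE.
Qed.

(** * Circuits in parallel *)

Section Parallel.
Variables (k : nat) (I O : 'I_k -> Type) (C : forall i, circuit (I i) (O i)).

(** With this shape, [flatten_index] turns gate [j] of circuit [i] into its number in the
    concatenation. *)
Definition par_shape : seq nat := [seq size (cgates (C i)) | i <- enum 'I_k].

Definition par_blocks :=
  [seq gates_map (fun w => inr (Tagged I w))
         (fun c => tagnat.Rank i c) (flatten_index par_shape i 0) (cgates (C i))
  | i <- enum 'I_k].

(* An output naming a nonexistent gate reads [false]; shifted, the reference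
   would hit a gate of a later circuit. *)
Definition par_out (i : 'I_k) (s : source (I i) (ccoins (C i))) :
    source {i & I i} (\sum_i ccoins (C i)) :=
  if s is SGate j then
    if (j < size (cgates (C i)))%N
    then SGate {i & I i} (\sum_i ccoins (C i)) (flatten_index par_shape i j)
    else SConst _ _ false
  else source_map (fun w => inr (Tagged I w)) (fun c => tagnat.Rank i c) 0 s.

Definition par : circuit {i & I i} {i & O i} :=
  @Circuit _ _ (\sum_i ccoins (C i)) (flatten par_blocks)
    (fun o => par_out (couts (C (tag o)) (tagged o))).

Lemma par_blocks_shape : shape par_blocks = par_shape.
Proof. by rewrite /shape -map_comp; apply: eq_map => i /=; rewrite size_map. Qed.

Lemma ctime_par : ctime par = (\sum_i ctime (C i))%N.
Proof.
rewrite /ctime /= big_split /=; congr addn.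
rewrite size_flatten par_blocks_shape /par_shape sumnE big_map big_enum //.
Qed.

Lemma gate_vals_par (x : bits {i & I i}) (rho : coins 'I_(ccoins par)) :
  gate_vals x rho (flatten par_blocks) =
  flatten [seq gate_vals (fun w => x (Tagged I w))
                 [ffun c => rho (tagnat.Rank i c)] (cgates (C i))
          | i <- enum 'I_k].
Proof.
set vals := [seq _ | i <- _].
have sz T (F : 'I_k -> T) : size [seq F i | i <- enum 'I_k] = k.
  by rewrite size_map size_enum_ord.
(* Induction on the number of blocks: each new block follows an evaluated prefix, whose length is
   exactly the offset of the block. *)
suff H m : (m <= k)%N ->
    gate_vals x rho (flatten (take m par_blocks)) = flatten (take m vals).
  have := H k (leqnn k).
  by rewrite !take_oversize ?sz.
elim: m => [|m IH] mk; first by rewrite !take0.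
pose i := Ordinal mk.
have nthE T (x0 : T) (F : 'I_k -> T) : nth x0 [seq F j | j <- enum 'I_k] m = F i.
  by rewrite (nth_map i) ?size_enum_ord // (nth_ord_enum i i).
rewrite !(take_nth [::]) ?sz // !nthE !flatten_rcons.
have -> : flatten_index par_shape i 0 = size (flatten (take m par_blocks)).
  by rewrite /flatten_index addn0 size_flatten -par_blocks_shape /shape map_take.
by rewrite gate_vals_cat_map IH // ltnW.
Qed.

Lemma run_par (x : bits {i & I i}) (rho : coins 'I_(ccoins par)) i (o : O i) :
  run par x rho (Tagged O o) =
  run (C i) (fun w => x (Tagged I w)) [ffun c => rho (tagnat.Rank i c)] o.
Proof.
rewrite /run /= gate_vals_par.
case: (couts (C i) o) => //= [c|j]; first by rewrite ffunE.
set vals := [seq _ | i <- _].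
have shE : shape vals = par_shape.
  by rewrite /shape -map_comp; apply: eq_map => l; rewrite /= size_gate_vals.
have nthE T (x0 : T) (F : 'I_k -> T) : nth x0 [seq F j | j <- enum 'I_k] i = F i.
  by rewrite (nth_map i) ?size_enum_ord // (nth_ord_enum i i).
(* Out of range, the constant [false] of [par_out] meets the default of [nth]; in range,
   [flatten_index] recovers both the block and the position in it. *)
case: ltnP => [ji|ij] /=; last by rewrite nth_default ?size_gate_vals.
have ji' : (j < nth 0 par_shape i)%N by rewrite nthE.
by rewrite nth_flatten shE (flatten_indexKl ji') (flatten_indexKr ji') nthE.
Qed.

End Parallel.

(** * The composed simulator and the reduction to one component *)

Section OrComposition.
Variables (M : message_space) (k : nat) (S : 'I_k -> scheme M) (n : nat).

(** The outer flag of a conditional ciphertext is always 1, hence a constant output; the inner flags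
    are left to the given simulators. *)
Definition or_simulator (Sim : forall i, simulator (S i) n) :
    simulator (or_scheme S) n :=
  @Circuit (pk_pos (or_scheme S) n) (option (ct_pos (or_scheme S) n))
    (ccoins (par Sim)) (cgates (par Sim))
    (fun o => if o is Some o' then couts (par Sim) o' else SConst _ _ true).

Lemma run_or_simulator (Sim : forall i, simulator (S i) n) pk
    (rho : coins 'I_(ccoins (par Sim))) :
  bits_ctxt (run (or_simulator Sim) pk rho) =
  or_ctxt true (fun i => bits_ctxt
    (run (Sim i) (component i pk) [ffun c => rho (tagnat.Rank i c)])).
Proof.
congr (_, _); apply/funext => -[i o].
rewrite /join /= -[LHS]/(run (par Sim) pk rho (Tagged _ o)) run_par.
by case: o.
Qed.

(** Only component [i] of the challenge ciphertext stays live. Its other components are frozen to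
    [x]; the bottom marker, the outer flag and the rest of the view are frozen to [V]. *)
Definition hardwire (i : 'I_k) (V : bits (view_pos (or_scheme S) n))
    (x : forall j, ctxt (ct_pos (S j) n)) (p : view_pos (or_scheme S) n) :
    bool + view_pos (S i) n :=
  match p with
  | VC (Some (Some (existT j w))) =>
      dfwith (T := fun j => option (ct_pos (S j) n) -> bool + view_pos (S i) n)
        (fun j w => inl (ctxt_bits (x j) w)) i (fun w => inr (VC (Some w))) j w
  | _ => inl (V p)
  end.

Lemma read_hardwire (i : 'I_k) (sk : bits (sk_pos (or_scheme S) n))
    (pk : bits (pk_pos (or_scheme S) n)) (m1 m2 m3 : M)
    (c1 : ctxt (ct_pos (or_scheme S) n))
    (x : forall j, ctxt (ct_pos (S j) n)) (ski : bits (sk_pos (S i) n))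
    (pki : bits (pk_pos (S i) n)) (c1i c : ctxt (ct_pos (S i) n)) :
  read_input (hardwire i (view sk pk m1 m2 m3 c1 (Some (or_ctxt true x))) x)
    (view ski pki m1 m2 m3 c1i (Some c)) =
  view sk pk m1 m2 m3 c1
    (Some (or_ctxt true (dfwith (T := fun j => ctxt (ct_pos (S j) n)) x i c))).
Proof.
apply/funext => -[//|//|//|//|//|//|[[[j w]|]|]] //=.
rewrite /read_input /= /join /=.
have [ij|ij] := eqVneq i j.
  by case: _ / ij w => w; rewrite !dfwithin.
by rewrite !dfwithout.
Qed.

End OrComposition.

Theorem theorem7 (R : realType) (M : message_space) (k : nat)
    (P : 'I_k -> M -> M -> bool) (S : 'I_k -> scheme M)
    (t : nat -> nat) (tSim : 'I_k -> nat -> nat)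
    (eps : 'I_k -> nat -> nat -> R)
    (hS : forall i, cond_secrecy (P i) (S i) t (tSim i) (eps i)) :
  exists t' : nat -> nat,
    [/\ (fun n => (t' n)%:R : R^o) =O_\oo (fun n => (t n)%:R : R^o),
        forall n, (t n <= t' n)%N
      & cond_secrecy (or_pred P) (or_scheme S) t'
          (fun n => (\sum_(i < k) tSim i n)%N)
          (fun s n => \sum_(i < k) eps i s n)].
Proof.
(* Choice turns the existence statements into a family of simulators. *)
pose Sim i := projT1 (cid (hS i)).
exists t; split => //.
  by apply/eqO_exP; exists 1 => //; apply: nearW => n; rewrite mul1r.
exists (fun n => or_simulator (fun i => Sim i n)); split=> [n|].
  (* The constant flag output costs nothing, so the size is that of [par]. *)
  rewrite -[ctime _]/(ctime (par (fun i => Sim i n))) ctime_par.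
  by apply: leq_sum => i _; exact: (projT2 (cid (hS i))).1.
move=> m1 m2 m3 Pm n r r1 D tD; cbv zeta.
set sk := (keygen r).1; set pk := (keygen r).2; set c1 := enc pk m1 r1.
(* Acceptance probability of [D], over its own coins only, as a function of the challenge
   components. *)
pose G (c : forall i, ctxt (ct_pos (S i) n)) : R :=
  avg (fun d =>
    (run D (view sk pk m1 m2 m3 c1 (Some (or_ctxt true c))) d tt)%:R).
pose ski i := (keygen (coin_component i r)).1.
pose pki i := (keygen (coin_component i r)).2.
pose f i (u : coins 'I_(ccoins (Sim i n))) :=
  bits_ctxt (run (Sim i n) (pki i) u).
pose c1i i := enc (pki i) m1 (coin_component i r1).
(* The default is never reached: [c1i i] is an honest ciphertext, so [cond_enc_regular] excludes
   bottom. *)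
pose g i (v : coins (cond_coin (S i) n)) :=
  odflt (true, fun=> false) (cond_enc (pki i) (c1i i) m2 m3 v).
have condE i v : cond_enc (pki i) (c1i i) m2 m3 v = Some (g i v).
  rewrite /g.
  have := @cond_enc_regular M (S i) n (coin_component i r) m1
    (coin_component i r1) m2 m3 v.
  by case: cond_enc.
rewrite !prob_avg.
rewrite (avg_pair (fun a d => (run D (view sk pk m1 m2 m3 c1
  (Some (bits_ctxt (run (or_simulator (Sim^~ n)) pk a)))) d tt)%:R)).
rewrite (avg_pair (fun b d => (run D (view sk pk m1 m2 m3 c1
  (cond_enc pk c1 m2 m3 b)) d tt)%:R)).
set sim_avg := avg _; set cond_avg := avg _.
have -> : sim_avg = avg (fun a : coins {i : 'I_k & 'I_(ccoins (Sim i n))} =>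
    G (fun i => f i (coin_component i a))).
  rewrite avg_coin_rank; congr avg; apply/funext => rho.
  rewrite run_or_simulator; congr (G _); apply/functional_extensionality_dep => i.
  by rewrite /f; congr (bits_ctxt (run _ _ _)); apply/ffunP => c; rewrite !ffunE.
have -> : cond_avg = avg (fun b : coins {i : 'I_k & cond_coin (S i) n} =>
    G (fun i => g i (coin_component i b))).
  congr avg; apply/funext => b.
  suff -> : cond_enc pk c1 m2 m3 b =
      Some (or_ctxt true (fun i => g i (coin_component i b))) by [].
  rewrite /cond_enc /= /or_cond_enc /=; case: ifPn => [_|/forallPn[i]].
    congr (Some (or_ctxt _ _)); apply/functional_extensionality_dep => i.
    by rewrite ct_component_or.
  by rewrite ct_component_or (condE i).
apply: (hybrid_bound (X := fun i => ctxt (ct_pos (S i) n))) => i x.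
have Pi : P i m1 m2 = false.
  by apply: contraFF Pm => Pim; apply/existsP; exists i.
(* [Di] may depend on keys, messages and frozen ciphertexts, since secrecy of [S i] quantifies over
   circuits after the messages and the coins [r], [r1] are fixed. *)
pose Di := rewire
  (hardwire i (view sk pk m1 m2 m3 c1 (Some (or_ctxt true x))) x) D.
have tDi : (ctime Di <= t n)%N by rewrite ctime_rewire.
have avgE (A : finType) (c : A -> ctxt (ct_pos (S i) n)) :
    avg (fun u => G (dfwith x i (c u))) =
    avg (fun w : A * coins 'I_(ccoins D) =>
      (run Di (view (ski i) (pki i) m1 m2 m3 (c1i i) (Some (c w.1))) w.2 tt)%:R).
  rewrite (avg_pair (fun u d => (run Di (view (ski i) (pki i) m1 m2 m3 (c1i i)
    (Some (c u))) d tt)%:R)).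
  congr avg; apply/funext => u; congr avg; apply/funext => d.
  by rewrite run_rewire read_hardwire.
rewrite !avgE.
have := (projT2 (cid (hS i))).2 m1 m2 m3 Pi n (coin_component i r)
  (coin_component i r1) Di tDi.
rewrite /= !prob_avg -/(ski i) -/(pki i) -/(c1i i).
congr (`|_ - avg _| <= _); apply/funext => w.
by rewrite condE.
Qed.
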